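(* Let $\Omega=\{1,\dots,n\}$, let $N$ be a positive integer and $\pi\in[1,\infty]$, with $\pi_*=\pi/(\pi-1)$ the conjugate exponent. Let $\rho_{\beta,n,\pi}(N)$ be any quantity such that for every probability distribution $f$ on $\Omega$, the empirical distribution $\hat f[x^N]$ of an $N$-element i.i.d. sample $x^N$ drawn from $f$ satisfies $\mathbb P\{\|\hat f[x^N]-f\|_\pi>\rho_{\beta,n,\pi}(N)\}\le\beta$. Let $X^1$, $X^2$ be independent samples of cardinality $2N$ each, i.i.d. from distributions $p$ and $q$ on $\Omega$ respectively. Split $X^1$ into non-overlapping subsamples $x^{\mathrm{tr}},x^{\mathrm{ts}}$ of cardinality $N$ each and $X^2$ into non-overlapping $\bar x^{\mathrm{tr}},\bar x^{\mathrm{ts}}$ of cardinality $N$ each, and let $\hat f[\cdot]$ denote empirical distributions. Using only $(x^{\mathrm{tr}},\bar x^{\mathrm{tr}})$, choose $e\in\mathbb R^n$ with $e^T(\hat f[x^{\mathrm{tr}}]-\hat f[\bar x^{\mathrm{tr}}])=\|\hat f[x^{\mathrm{tr}}]-\hat f[\bar x^{\mathrm{tr}}]\|_\pi$ and $\|e\|_{\pi_*}=1$, and set $h=e/\|e\|_\infty$. Let $\chi=h^T(\hat f[x^{\mathrm{ts}}]-\hat f[\bar x^{\mathrm{ts}}])$. For $\alpha\in(0,1)$ let $\tau_N(\alpha)$ be the positive root of $\dfrac{\tau^2}{1+\frac23\tau}=\dfrac2N\ln(2/\alpha)$, let $\tau'_N(\alpha)=\min\{1,\tau_N(\alpha)\}$,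 and let the test $\mathcal T^N_{\pi,\alpha}$ claim $H_1$ if and only if $\chi>\ell:=2\tau'_N(\alpha)$. Then: (1) if $p=q$, the probability that $\mathcal T^N_{\pi,\alpha}$ claims $H_1$ is at most $\alpha$; (2) for $\beta\in(0,1/4)$, if $\|p-q\|_\pi\ge6\rho_{\beta,n,\pi}(N)+2\tau'_N(\alpha)$, then the probability that $\mathcal T^N_{\pi,\alpha}$ does not claim $H_1$ is at most $4\beta$.
   Context: The empirical distribution of a set of observations in $\{1,\dots,n\}$ is the vector of relative frequencies. *)

(* Defs.v *)
From HB Require Import structures.
From mathcomp Require Import all_boot all_order all_algebra all_fingroup.
From mathcomp Require Import all_classical all_reals all_analysis.
Set Implicit Arguments. Unset Strict Implicit. Unset Printing Implicit Defensive.
Import Order.TTheory GRing.Theory Num.Theory.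
Local Open Scope ring_scope.

Section Defs.
Variable R : realType.

Definition lpnorm (n : nat) (pi : \bar R) (v : 'I_n -> R) : R :=
  match pi with
  | r%:E => (\sum_(i < n) `|v i| `^ r) `^ (r^-1)
  | +oo%E => \big[Num.max/0]_(i < n) `|v i|
  | -oo%E => 0
  end.

Definition conj_exp (pi : \bar R) : \bar R :=
  match pi with
  | r%:E => if r == 1 then +oo%E else (r / (r - 1))%:E
  | +oo%E => 1%:E
  | -oo%E => -oo%E
  end.

Definition is_distr (n : nat) (f : 'I_n -> R) : Prop :=
  (forall i, 0 <= f i) /\ \sum_(i < n) f i = 1.

Definition emp (n N : nat) (x : 'I_N -> 'I_n) : 'I_n -> R :=
  fun i => #|[set k | x k == i]|%:R / N%:R.

Definition Prob_iid (n N : nat) (f : 'I_n -> R)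
  (A : pred {ffun 'I_N -> 'I_n}) : R :=
  \sum_(x : {ffun 'I_N -> 'I_n} | A x) \prod_(k < N) f (x k).

Definition Prob_iid2 (n M : nat) (p q : 'I_n -> R)
  (A : {ffun 'I_M -> 'I_n} -> {ffun 'I_M -> 'I_n} -> bool) : R :=
  \sum_(X1 : {ffun 'I_M -> 'I_n})
   \sum_(X2 : {ffun 'I_M -> 'I_n} | A X1 X2)
     (\prod_(k < M) p (X1 k)) * (\prod_(k < M) q (X2 k)).

(* splitting a sample of size N+N into two non-overlapping subsamples of
   size N, along an arbitrary permutation s of the indices *)
Definition split_tr (n N : nat) (s : 'S_(N + N)) (X : 'I_(N + N) -> 'I_n)
  : 'I_N -> 'I_n := fun k => X (s (lshift N k)).
Definition split_ts (n N : nat) (s : 'S_(N + N)) (X : 'I_(N + N) -> 'I_n)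
  : 'I_N -> 'I_n := fun k => X (s (rshift N k)).

(* the statistic chi, given the selection rule E for e (depending only on
   the training subsamples) *)
Definition chi_stat (n N : nat)
  (E : ('I_N -> 'I_n) -> ('I_N -> 'I_n) -> 'I_n -> R)
  (s1 s2 : 'S_(N + N)) (X1 X2 : 'I_(N + N) -> 'I_n) : R :=
  let xtr := split_tr s1 X1 in let xts := split_ts s1 X1 in
  let ytr := split_tr s2 X2 in let yts := split_ts s2 X2 in
  let e := E xtr ytr in
  let h := fun i => e i / lpnorm +oo%E e in
  \sum_(i < n) h i * (emp xts i - emp yts i).

Definition claims_H1 (n N : nat)
  (E : ('I_N -> 'I_n) -> ('I_N -> 'I_n) -> 'I_n -> R)
  (s1 s2 : 'S_(N + N)) (tau : R) (X1 X2 : 'I_(N + N) -> 'I_n) : bool :=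
  chi_stat E s1 s2 X1 X2 > 2 * Num.min 1 tau.

End Defs.
Arguments emp {R n N} x i.
Arguments lpnorm {R n} pi v.
Arguments Prob_iid {R n N} f A.
Arguments Prob_iid2 {R n M} p q A.
Arguments chi_stat {R n N} E s1 s2 X1 X2.
Arguments claims_H1 {R n N} E s1 s2 tau X1 X2.

(* Main.v *)
Require Import Defs.
From HB Require Import structures.
From mathcomp Require Import all_boot all_order all_algebra all_fingroup.
From mathcomp Require Import all_classical all_reals all_analysis.
From mathcomp Require Import ring lra.
Import Order.TTheory GRing.Theory Num.Theory.
Local Open Scope ring_scope.

(** Type I error.  For p = q and a fixed training sample, N chi is a sum of N
    independent copies of h(x) - h(y) with x, y i.i.d., hence symmetric and at
    most 2 in absolute value, so cosh z <= exp (z^2 / 2) and Chernoff's bound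
    give P(chi > 2 tau) <= exp (- N tau^2 / 2) <= alpha; if tau >= 1 the event
    is empty since chi <= 2.

    Type II error.  By Hoelder and Minkowski, if the four empirical
    distributions are rho-close to p, p, q, q, then
    e . (f[x_ts] - f[y_ts]) >= ||p - q|| - 6 rho >= 2 tau', and dividing by
    ||e||_oo <= 1 only helps.  The test needs a strict inequality, so the event
    for x_ts is enlarged to the closed one e . (f[x_ts] - p) <= - rho, which
    still has probability at most beta because the hypothesis on rho also holds
    for distributions arbitrarily close to p. *)

(** * The p-norms: Minkowski and Hoelder inequalities *)

Section LpNorm.
Context {R : realType} {n : nat}.
Implicit Types (u v e : 'I_n -> R) (r c : R) (pi : \bar R).

Lemma lpnorm_ge0 pi v : 0 <= lpnorm pi v.
Proof.
case: pi => [r| |] /=; [exact: powR_ge0|exact: bigmax_ge_id|by []].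
Qed.

Lemma lpnorm0 pi : (1 <= pi)%E -> lpnorm pi (fun _ : 'I_n => 0 : R) = 0.
Proof.
case: pi => [r| |] //; last first.
  by move=> _ /=; apply/le_anti; rewrite bigmax_ge_id andbT; apply: bigmax_le => // i _;
    rewrite normr0.
rewrite lee_fin => r1; have r0 : r != 0 by rewrite gt_eqF// (lt_le_trans _ r1).
by rewrite /lpnorm big1 ?powR0 ?invr_eq0// => i _; rewrite normr0 powR0.
Qed.

Lemma lpnorm_opp pi v : lpnorm pi (fun i => - v i) = lpnorm pi v.
Proof.
rewrite /lpnorm; case: pi => [r| |]; last by [].
- congr (powR _ _); apply: eq_bigr => i _; by rewrite normrN.
- by apply: eq_bigr => i _; rewrite normrN.
Qed.

Lemma lpnormB pi u v : lpnorm pi (fun i => u i - v i) = lpnorm pi (fun i => v i - u i).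
Proof.
by rewrite -lpnorm_opp; congr lpnorm; apply/funext => i; rewrite opprB.
Qed.

(** Trades the outer root for a normalized sum, to which convexity and Young's inequality apply term
    by term. *)
Lemma lpnorm_fin_le r c v : 0 < r -> 0 < c ->
  lpnorm r%:E v <= c <-> \sum_(i < n) (`|v i| / c) `^ r <= 1.
Proof.
move=> r0 c0; have cr0 : 0 < c `^ r by exact: powR_gt0.
have -> : \sum_(i < n) (`|v i| / c) `^ r = (\sum_(i < n) `|v i| `^ r) / c `^ r.
  rewrite big_distrl /=; apply: eq_bigr => i _.
  rewrite powRM ?invr_ge0 ?(ltW c0)//; congr (_ * _).
  by rewrite -(powR_inv1 (ltW c0)) -powRrM mulN1r powRN.
rewrite ler_pdivrMr// mul1r /=.
set S := \sum_(i < n) _; have S0 : 0 <= S by apply: sumr_ge0 => i _; exact: powR_ge0.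
have SE : (S `^ r^-1) `^ r = S by rewrite -powRrM mulVf ?gt_eqF// powRr1.
split => h.
  rewrite -SE; apply: ge0_ler_powR; rewrite ?nnegrE ?powR_ge0 ?(ltW r0) ?(ltW c0)//.
have -> : c = (c `^ r) `^ r^-1 by rewrite -powRrM mulfV ?gt_eqF// powRr1// ltW.
by apply: ge0_ler_powR; rewrite ?nnegrE ?powR_ge0 ?invr_ge0 ?(ltW r0).
Qed.

Lemma coord_le_lpnorm pi v i : (1 <= pi)%E -> `|v i| <= lpnorm pi v.
Proof.
case: pi => [r| |] //=; last first.
  by move=> _; apply: (le_bigmax 0 (fun i => `|v i|) i).
rewrite lee_fin => r1; have r0 : 0 < r by exact: lt_le_trans r1.
have {1}-> : `|v i| = (`|v i| `^ r) `^ r^-1.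
  by rewrite -powRrM mulfV ?gt_eqF// powRr1.
apply: ge0_ler_powR; rewrite ?nnegrE ?powR_ge0 ?invr_ge0 ?(ltW r0)//.
  by apply: sumr_ge0 => j _; exact: powR_ge0.
rewrite (bigD1 i)//= lerDl; apply: sumr_ge0 => j _; exact: powR_ge0.
Qed.

Lemma powR_conv r (s t x y : R) : 1 <= r -> 0 <= s -> 0 <= t -> s + t = 1 ->
  0 <= x -> 0 <= y -> (s * x + t * y) `^ r <= s * x `^ r + t * y `^ r.
Proof.
move=> r1 s0 t0 st x0 y0; have s1 : s <= 1 by lra.
have -> : t = 1 - s by lra.
by apply: (convex_powR r1 (Itv01 s0 s1)); rewrite inE /= in_itv /= ?x0 ?y0.
Qed.

(** Convexity of the unit ball: (u + v) / (a + b) is the convex combination of u / a and v / b with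
    weights a / (a + b) and b / (a + b). *)
Lemma lpnorm_finD_le r (a b : R) u v : 1 <= r -> 0 < a -> 0 < b ->
  lpnorm r%:E u <= a -> lpnorm r%:E v <= b ->
  lpnorm r%:E (fun i => u i + v i) <= a + b.
Proof.
move=> r1 a0 b0; have r0 : 0 < r by exact: lt_le_trans r1.
have ab0 : 0 < a + b by rewrite addr_gt0.
move=> /(lpnorm_fin_le _ _ u r0 a0) ha /(lpnorm_fin_le _ _ v r0 b0) hb.
apply/(lpnorm_fin_le _ _ _ r0 ab0).
have s0 : 0 <= a / (a + b) by rewrite divr_ge0 ?ltW.
have t0 : 0 <= b / (a + b) by rewrite divr_ge0 ?ltW.
have st : a / (a + b) + b / (a + b) = 1 by rewrite -mulrDl mulfV// gt_eqF.
apply: (@le_trans _ _ (\sum_(i < n) (a / (a + b) * (`|u i| / a) `^ r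
                                    + b / (a + b) * (`|v i| / b) `^ r))).
  apply: ler_sum => i _.
  have ua0 : 0 <= `|u i| / a := divr_ge0 (normr_ge0 _) (ltW a0).
  have vb0 : 0 <= `|v i| / b := divr_ge0 (normr_ge0 _) (ltW b0).
  apply: le_trans (powR_conv r _ _ _ _ r1 s0 t0 st ua0 vb0).
  have -> : a / (a + b) * (`|u i| / a) + b / (a + b) * (`|v i| / b)
            = (`|u i| + `|v i|) / (a + b).
    by field; rewrite !gt_eqF.
  apply: ge0_ler_powR; rewrite ?nnegrE ?(ltW r0)//.
  - exact: divr_ge0 (normr_ge0 _) (ltW ab0).
  - exact: divr_ge0 (addr_ge0 (normr_ge0 _) (normr_ge0 _)) (ltW ab0).
  - by rewrite ler_pM2r ?invr_gt0// ler_normD.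
rewrite big_split /= -!big_distrr /=.
rewrite -[X in _ <= X]st; apply: lerD; rewrite ler_piMr//.
Qed.

Lemma ler_lpnormD pi u v : (1 <= pi)%E ->
  lpnorm pi (fun i => u i + v i) <= lpnorm pi u + lpnorm pi v.
Proof.
case: pi => [r| |] //; last first.
  move=> _ /=; apply: bigmax_le => [|i _].
    by apply: addr_ge0; exact: bigmax_ge_id.
  apply: le_trans (ler_normD _ _) _; apply: lerD.
  - exact: (le_bigmax 0 (fun i => `|u i|) i).
  - exact: (le_bigmax 0 (fun i => `|v i|) i).
rewrite lee_fin => r1.
(* Half of eps is added to each norm, since the radii must be positive even when a norm vanishes. *)
apply/ler_addgt0Pr => eps eps0.
rewrite [eps]splitr addrACA.
by apply: lpnorm_finD_le => //; rewrite ?ltr_wpDl ?lpnorm_ge0 ?lerDl ?divr_ge0 ?divr_gt0// ltW.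
Qed.

Lemma hoelder_lpnorm pi e v : (1 <= pi)%E -> lpnorm (conj_exp pi) e = 1 ->
  \sum_(i < n) e i * v i <= lpnorm pi v.
Proof.
case: pi => [r| |] //; last first.
  rewrite /= => _; rewrite invr1 powRr1; last by apply: sumr_ge0 => i _; exact: powR_ge0.
  move=> e1.
  apply: (@le_trans _ _ (\sum_(i < n) `|e i| `^ 1 * \big[Num.max/0]_(i < n) `|v i|)).
    apply: ler_sum => i _; apply: le_trans (ler_norm _) _.
    rewrite normrM powRr1//; apply: ler_wpM2l => //.
    exact: (le_bigmax 0 (fun i => `|v i|) i).
  by rewrite -big_distrl /= e1 mul1r.
rewrite lee_fin /= => r1; have r0 : 0 < r by exact: lt_le_trans r1.
case: eqP => [->|/eqP r_neq1] /=.
  move=> e1; rewrite invr1 powRr1; last by apply: sumr_ge0 => i _; exact: powR_ge0.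
  apply: ler_sum => i _; apply: le_trans (ler_norm _) _.
  rewrite normrM powRr1// ler_piMl// -e1.
  exact: (le_bigmax 0 (fun i => `|e i|) i).
set q := r / (r - 1).
have r1' : 0 < r - 1 by rewrite subr_gt0 lt_neqAle eq_sym r_neq1.
have q0 : 0 < q by rewrite divr_gt0.
have rq : q^-1 + r^-1 = 1 by rewrite /q; field; rewrite !gt_eqF.
move=> e1; have {e1} : lpnorm q%:E e <= 1 by rewrite /= e1.
move=> /(lpnorm_fin_le _ _ _ q0 ltr01) he.
rewrite -[X in _ <= X]/(lpnorm r%:E v).
(* Scaling v by c > 0 puts both vectors in their unit balls; summing Young's inequality then gives
   at most 1/q + 1/r = 1. *)
apply/ler_addgt0Pr => eps eps0; set c := _ + eps.
have c0 : 0 < c by apply: ltr_wpDl => //; exact: lpnorm_ge0.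
have : lpnorm r%:E v <= c by rewrite /c lerDl ltW.
move=> /(lpnorm_fin_le _ _ _ r0 c0) hv.
rewrite -[X in _ <= X]mul1r -ler_pdivrMr// big_distrl /=.
apply: (@le_trans _ _ (\sum_(i < n) ((`|e i| / 1) `^ q / q + (`|v i| / c) `^ r / r))).
  apply: ler_sum => i _; rewrite divr1.
  apply: le_trans (conjugate_powR _ _ q0 r0 rq) => //; last by rewrite divr_ge0// ltW.
  by rewrite mulrA ler_pM2r ?invr_gt0// -normrM ler_norm.
rewrite big_split /= -!big_distrl /= -[X in _ <= X]rq; apply: lerD.
  by rewrite ler_piMl// invr_ge0 ltW.
by rewrite ler_piMl// invr_ge0 ltW.
Qed.

Lemma conj_exp_ge1 pi : (1 <= pi)%E -> (1 <= conj_exp pi)%E.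
Proof.
case: pi => [r| |] //=; rewrite lee_fin => r1.
case: eqP => [_|/eqP r_neq1]; first by rewrite leey.
have r1' : 0 < r - 1 by rewrite subr_gt0 lt_neqAle eq_sym r_neq1.
by rewrite lee_fin ler_pdivlMr//; lra.
Qed.

End LpNorm.

(** * The bound cosh x <= exp (x^2 / 2) *)

Section Subgaussian.
Context {R : realType}.

(** The difference of the two sides vanishes at 0 and has derivative y (exp y - exp (- y)) >= 0. It
    supplies the sign of the derivative in the next lemma. *)
Lemma one_subX_expR_le (x : R) : 0 <= x ->
  (1 - x) * expR x <= (1 + x) * expR (- x).
Proof.
move=> x0; rewrite -subr_ge0.
pose g (y : R) := (1 + y) * expR (- y) - (1 - y) * expR y.
have dg (y : R) : is_derive y 1 g (y * (expR y - expR (- y))).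
  by rewrite /g; apply: is_derive_eq; rewrite /GRing.scale /=; ring.
have : g 0 <= g x.
  apply: (@ger0_derive1_le_cc R g 0 x) => //.
  - by move=> y; rewrite in_itv /= => /andP[/ltW y0 _]; rewrite derive1E derive_val
      mulr_ge0// subr_ge0 ler_expR; lra.
  - by apply: derivable_within_continuous => y _.
  - by rewrite in_itv /= lexx.
  - by rewrite in_itv /= lexx andbT.
by rewrite /g oppr0 expR0 !addr0 !mulr1 subrr.
Qed.

Lemma cosh_le_expR_sqr (x : R) : expR x + expR (- x) <= 2 * expR (x ^+ 2 / 2).
Proof.
wlog x0 : x / 0 <= x => [wl|].
  have [|/ltW x0] := leP 0 x; first exact: wl.
  by have := wl (- x); rewrite opprK sqrrN addrC; apply; rewrite oppr_ge0.
(* This is 2 cosh y exp (- y^2 / 2); it equals 2 at 0 and is nonincreasing for y >= 0. *)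
pose f (y : R) := expR (y - y ^+ 2 / 2) + expR (- y - y ^+ 2 / 2).
have df (y : R) : is_derive y 1 f
    ((1 - y) * expR (y - y ^+ 2 / 2) - (1 + y) * expR (- y - y ^+ 2 / 2)).
  rewrite /f; apply: is_derive_eq; rewrite /GRing.scale /=.
  by field; rewrite ?pnatr_eq0.
have : f x <= f 0.
  apply: (@ler0_derive1_le_cc R f 0 x) => //.
  - move=> y; rewrite in_itv /= => /andP[/ltW y0 _]; rewrite derive1E derive_val.
    by rewrite !expRD !mulrA -mulrBl mulr_le0_ge0 ?expR_ge0// subr_le0 one_subX_expR_le.
  - by apply: derivable_within_continuous => y _.
  - by rewrite in_itv /= lexx andbT.
  - by rewrite in_itv /= lexx.
rewrite /f !expRD -mulrDl (expRN (x ^+ 2 / 2)) ler_pdivrMr ?expR_gt0//.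
by rewrite oppr0 expr0n /= mul0r oppr0 expR0 mulr1.
Qed.

End Subgaussian.

(** * Expectations over i.i.d. samples and sample splitting *)

Section IidExpectation.
Context {R : realType} {n : nat}.
Implicit Types (p q : 'I_n -> R).

(** Probabilities become expectations of indicators, so that linearity, monotonicity and exchange of
    order can be used. *)
Definition iid_exp {N : nat} p (F : {ffun 'I_N -> 'I_n} -> R) : R :=
  \sum_(x : {ffun 'I_N -> 'I_n}) (\prod_(k < N) p (x k)) * F x.

Lemma iid_exp_prod N p (phi : 'I_n -> R) :
  iid_exp p (fun x : {ffun 'I_N -> 'I_n} => \prod_(k < N) phi (x k))
  = (\sum_i p i * phi i) ^+ N.
Proof.
rewrite /iid_exp -[X in _ ^+ X]card_ord -prodr_const.
rewrite (bigA_distr_bigA (fun (_ : 'I_N) i => p i * phi i)) /=.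
by apply: eq_bigr => x _; rewrite big_split.
Qed.

Lemma iid_exp_cst N p c : is_distr p ->
  iid_exp p (fun _ : {ffun 'I_N -> 'I_n} => c) = c.
Proof.
(* The product formula with the constant 1 says that the sample weights have total mass 1. *)
move=> [_ p1]; have := @iid_exp_prod N p (fun=> 1).
have -> : \sum_i p i * 1 = 1 by rewrite -[RHS]p1; apply: eq_bigr => i _; rewrite mulr1.
rewrite expr1n /iid_exp => h.
rewrite -big_distrl /= -[RHS]mul1r -[X in _ = X * _]h; congr (_ * _).
by apply: eq_bigr => x _; rewrite big1_eq mulr1.
Qed.

Lemma iid_expD N p (F G : {ffun 'I_N -> 'I_n} -> R) :
  iid_exp p (fun x => F x + G x) = iid_exp p F + iid_exp p G.
Proof.
by rewrite /iid_exp -big_split /=; apply: eq_bigr => x _; rewrite mulrDr.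
Qed.

Lemma iid_expZ N p c (F : {ffun 'I_N -> 'I_n} -> R) :
  iid_exp p (fun x => c * F x) = c * iid_exp p F.
Proof.
by rewrite /iid_exp big_distrr /=; apply: eq_bigr => x _; rewrite mulrCA.
Qed.

Lemma ler_iid_exp N p (F G : {ffun 'I_N -> 'I_n} -> R) : is_distr p ->
  (forall x, F x <= G x) -> iid_exp p F <= iid_exp p G.
Proof.
move=> [p0 _] FG; apply: ler_sum => x _; apply: ler_wpM2l => //.
by apply: prodr_ge0 => k _.
Qed.

Lemma eq_iid_exp N p (F G : {ffun 'I_N -> 'I_n} -> R) :
  (forall x, F x = G x) -> iid_exp p F = iid_exp p G.
Proof. by move=> FG; congr (iid_exp p _); apply/funext. Qed.

Lemma iid_exp_le_cst N p c (F : {ffun 'I_N -> 'I_n} -> R) : is_distr p ->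
  (forall x, F x <= c) -> iid_exp p F <= c.
Proof.
move=> dp Fc; rewrite -[X in _ <= X](@iid_exp_cst N p c dp).
exact: ler_iid_exp.
Qed.

Lemma iid_exp_exchange N M p q
    (F : {ffun 'I_N -> 'I_n} -> {ffun 'I_M -> 'I_n} -> R) :
  iid_exp p (fun x => iid_exp q (fun y => F x y))
  = iid_exp q (fun y => iid_exp p (fun x => F x y)).
Proof.
rewrite /iid_exp; under eq_bigr do rewrite big_distrr /=.
rewrite exchange_big /=; apply: eq_bigr => y _; rewrite big_distrr /=.
by apply: eq_bigr => x _; rewrite mulrCA.
Qed.

Lemma Prob_iidE N p (A : pred {ffun 'I_N -> 'I_n}) :
  Prob_iid p A = iid_exp p (fun x => (A x)%:R).
Proof.
rewrite /Prob_iid /iid_exp big_mkcond /=; apply: eq_bigr => x _.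
by case: (A x); rewrite ?mulr1 ?mulr0.
Qed.

Lemma Prob_iid2E M p q
    (A : {ffun 'I_M -> 'I_n} -> {ffun 'I_M -> 'I_n} -> bool) :
  Prob_iid2 p q A = iid_exp p (fun X1 => iid_exp q (fun X2 => (A X1 X2)%:R)).
Proof.
rewrite /Prob_iid2 /iid_exp; apply: eq_bigr => x _.
rewrite big_mkcond /= big_distrr /=; apply: eq_bigr => y _.
by case: (A x y); rewrite ?mulr1 ?mulr0 ?mulr0.
Qed.

Lemma iid_exp_split N p (s : 'S_(N + N))
    (G : ('I_N -> 'I_n) -> ('I_N -> 'I_n) -> R) :
  iid_exp p (fun X : {ffun 'I_(N + N) -> 'I_n} => G (split_tr s X) (split_ts s X))
  = iid_exp p (fun a : {ffun 'I_N -> 'I_n} =>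
      iid_exp p (fun b : {ffun 'I_N -> 'I_n} => G a b)).
Proof.
rewrite /iid_exp; under [RHS]eq_bigr do rewrite big_distrr /=.
rewrite pair_big /=.
(* [glue] and [cut] are inverse bijections between pairs of half samples and full samples; undoing
   [s] makes the product weights factor over the halves. *)
pose glue (ab : {ffun 'I_N -> 'I_n} * {ffun 'I_N -> 'I_n}) :
    {ffun 'I_(N + N) -> 'I_n} :=
  [ffun k : 'I_(N + N) => match fintype.split ((s^-1)%g k) with
                          | inl i => ab.1 i | inr j => ab.2 j end].
pose cut (X : {ffun 'I_(N + N) -> 'I_n}) :
    {ffun 'I_N -> 'I_n} * {ffun 'I_N -> 'I_n} :=
  ([ffun k => split_tr s X k], [ffun k => split_ts s X k]).
have gluel ab k : glue ab (s (lshift N k)) = ab.1 k.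
  by rewrite ffunE permK (unsplitK (inl _ k)).
have gluer ab k : glue ab (s (rshift N k)) = ab.2 k.
  by rewrite ffunE permK (unsplitK (inr _ k)).
rewrite (reindex glue) /=; last first.
  exists cut => [[a b] _|X _].
    by congr pair; apply/ffunP => k; rewrite ffunE /split_tr /split_ts ?gluel ?gluer.
  apply/ffunP => k; rewrite ffunE -[k in RHS](permKV s).
  by case: splitP => j /= jE; rewrite ffunE; congr (X (s _)); apply: val_inj.
apply: eq_bigr => -[a b] _ /=.
have -> : split_tr s (glue (a, b)) = a by apply/funext => k; exact: gluel.
have -> : split_ts s (glue (a, b)) = b by apply/funext => k; exact: gluer.
rewrite mulrA; congr (_ * _).
rewrite (reindex_inj (@perm_inj _ s)) big_split_ord /=.
by congr (_ * _); apply: eq_bigr => k _; rewrite ?gluel ?gluer.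
Qed.

Lemma emp_dot N (x : 'I_N -> 'I_n) (e : 'I_n -> R) :
  \sum_i e i * emp x i = (\sum_(k < N) e (x k)) / N%:R.
Proof.
rewrite /emp; under eq_bigr do rewrite mulrA.
rewrite -big_distrl /=; congr (_ / _).
(* Sample indices are grouped by observed value; the group of i has the cardinality counted by
   [emp]. *)
rewrite (partition_big x xpredT) //=; apply: eq_bigr => i _.
rewrite (eq_bigr (fun=> e i)) => [|k /eqP -> //].
by rewrite sumr_const mulr_natr; congr (_ *+ _); apply: eq_card => k; rewrite !inE.
Qed.

End IidExpectation.

(** * Type I error: symmetrization and Chernoff's bound *)

Section TypeI.
Context {R : realType} {n : nat}.
Implicit Types (p h : 'I_n -> R).

(** The product is the moment generating function of h(x) - h(y) for independent x, y. Averaging it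
    with its swap gives a cosh whose argument is at most 2 |lam| in absolute value. *)
Lemma symmetrized_mgf_le p h (lam : R) : is_distr p -> (forall i, `|h i| <= 1) ->
  (\sum_i p i * expR (lam * h i)) * (\sum_i p i * expR (- (lam * h i)))
  <= expR (2 * lam ^+ 2).
Proof.
move=> [p0 p1] h1.
set A := \sum_i p i * expR (lam * h i).
set B := \sum_i p i * expR (- (lam * h i)).
have ABE : A * B + B * A =
    \sum_i \sum_j p i * p j *
      (expR (lam * h i - lam * h j) + expR (- (lam * h i - lam * h j))).
  rewrite /A /B !big_distrlr /= -big_split /=; apply: eq_bigr => i _.
  rewrite -big_split /=; apply: eq_bigr => j _.
  by rewrite opprB !expRD; ring.
have : A * B + B * A <= \sum_i \sum_j p i * p j * (2 * expR (2 * lam ^+ 2)).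
  rewrite ABE; apply: ler_sum => i _; apply: ler_sum => j _.
  apply: ler_wpM2l; first exact: mulr_ge0.
  apply: le_trans (cosh_le_expR_sqr _) _; rewrite ler_pM2l// ler_expR.
  have -> : 2 * lam ^+ 2 = lam ^+ 2 * 2 ^+ 2 / 2 by field.
  rewrite -mulrBr exprMn ler_pM2r ?invr_gt0//; apply: ler_wpM2l; first exact: sqr_ge0.
  rewrite -(real_normK (num_real (h i - h j))) lerXn2r ?nnegrE//.
  apply: le_trans (ler_normB _ _) _.
  by rewrite (le_trans (lerD (h1 i) (h1 j))).
have -> : \sum_i \sum_j p i * p j * (2 * expR (2 * lam ^+ 2))
          = 2 * expR (2 * lam ^+ 2).
  under eq_bigr do rewrite -big_distrl /= -big_distrr /= p1 mulr1.
  by rewrite -big_distrl /= p1 mul1r.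
by rewrite [B * A]mulrC -mulr2n -[X in X <= _]mulr_natl ler_pM2l.
Qed.

Lemma emp_dotB N (x y : 'I_N -> 'I_n) h :
  \sum_i h i * (emp x i - emp y i)
  = (\sum_(k < N) h (x k) - \sum_(k < N) h (y k)) / N%:R.
Proof.
rewrite mulrBl -!emp_dot -sumrB; apply: eq_bigr => i _.
by rewrite mulrBr.
Qed.

Lemma two_sample_chernoff N p h (tau : R) : (0 < N)%N -> is_distr p ->
  (forall i, `|h i| <= 1) -> 0 < tau ->
  iid_exp p (fun b : {ffun 'I_N -> 'I_n} =>
    iid_exp p (fun d : {ffun 'I_N -> 'I_n} =>
      (\sum_i h i * (emp b i - emp d i) > 2 * tau)%R%:R))
  <= expR (- (N%:R * tau ^+ 2 / 2)).
Proof.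
move=> N0 dp h1 tau0.
have NR : 0 < N%:R :> R by rewrite ltr0n.
(* This value minimizes the Chernoff exponent N (2 lam^2 - 2 lam tau), with minimum - N tau^2 /
   2. *)
pose lam := tau / 2.
pose K := expR (- (N%:R * tau ^+ 2)).
pose U (b : {ffun 'I_N -> 'I_n}) := \prod_(k < N) expR (lam * h (b k)).
pose V (b : {ffun 'I_N -> 'I_n}) := \prod_(k < N) expR (- (lam * h (b k))).
apply: (@le_trans _ _ (iid_exp p (fun b : {ffun 'I_N -> 'I_n} =>
    iid_exp p (fun d : {ffun 'I_N -> 'I_n} => K * U b * V d)))).
  apply: ler_iid_exp => // b; apply: ler_iid_exp => // d.
  (* In this form the integrand visibly dominates the indicator: it is positive, and at least 1 on
     the event. *)
  have -> : K * U b * V d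
    = expR (lam * N%:R * (\sum_i h i * (emp b i - emp d i) - 2 * tau)).
    rewrite /K /U /V -!expR_sum -!expRD; congr expR.
    rewrite sumrN -!big_distrr /= emp_dotB /lam; field.
    by rewrite ?pnatr_eq0 gt_eqF.
  case: (ltP (2 * tau)) => [lt|_]; last exact: expR_ge0.
  rewrite -[X in X <= _]expR0 ler_expR mulr_ge0//.
    by rewrite /lam !mulr_ge0// ltW.
  by rewrite subr_ge0 ltW.
under eq_iid_exp do rewrite iid_expZ.
have -> : iid_exp p (fun b => K * U b * iid_exp p V) = iid_exp p V * K * iid_exp p U.
  by rewrite -iid_expZ; apply: eq_iid_exp => b; ring.
rewrite (iid_exp_prod N p (fun i => expR (lam * h i))).
rewrite (iid_exp_prod N p (fun i => expR (- (lam * h i)))).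
rewrite mulrAC mulrC [X in K * X]mulrC -exprMn.
have := symmetrized_mgf_le p h lam dp h1.
set T := _ * _ => hT.
have T0 : 0 <= T.
  by apply: mulr_ge0; apply: sumr_ge0 => i _; rewrite mulr_ge0 ?expR_ge0//; case: dp.
apply: (@le_trans _ _ (K * expR (2 * lam ^+ 2) ^+ N)).
  by rewrite ler_pM2l ?expR_gt0// lerXn2r ?nnegrE ?expR_ge0.
rewrite -expRM_natl /K -expRD ler_expR /lam.
by rewrite le_eqVlt; apply/orP; left; apply/eqP; field.
Qed.

(** The equation for tau turns N tau^2 / 2 into ln (2 / alpha) (1 + 2 tau / 3) >= ln (2 / alpha), so
    the bound is even at most alpha / 2. *)
Lemma chernoff_le_alpha N (alpha tau : R) : (0 < N)%N -> 0 < alpha < 1 -> 0 < tau ->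
  tau ^+ 2 / (1 + 2 / 3 * tau) = 2 / N%:R * ln (2 / alpha) ->
  expR (- (N%:R * tau ^+ 2 / 2)) <= alpha.
Proof.
move=> N0 /andP[a0 a1] tau0.
have NR : 0 < N%:R :> R by rewrite ltr0n.
have D1 : 1 <= 1 + 2 / 3 * tau by lra.
have D0 : 0 < 1 + 2 / 3 * tau by lra.
move=> tauE.
have two : 0 < 2 / alpha by rewrite divr_gt0.
have L0 : 0 <= ln (2 / alpha) by rewrite ln_ge0// ler_pdivlMr//; lra.
have -> : N%:R * tau ^+ 2 / 2 = ln (2 / alpha) * (1 + 2 / 3 * tau).
  rewrite -[tau ^+ 2](divfK (lt0r_neq0 D0)) tauE; field.
  by rewrite gt_eqF.
apply: (@le_trans _ _ (expR (- ln (2 / alpha)))).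
  by rewrite ler_expR lerN2 ler_peMr.
rewrite expRN lnK ?posrE// invf_div ler_pdivrMr//; lra.
Qed.

Lemma normalized_coord_le1 (e : 'I_n -> R) i : `|e i / lpnorm +oo%E e| <= 1.
Proof.
have m0 := lpnorm_ge0 +oo%E e.
(* When the norm is 0, the quotient is 0 because the inverse of 0 is 0. *)
have [->|mN0] := eqVneq (lpnorm +oo%E e) 0; first by rewrite invr0 mulr0 normr0.
have m1 : 0 < lpnorm +oo%E e by rewrite lt_neqAle eq_sym mN0.
rewrite normrM normfV (ger0_norm m0) ler_pdivrMr// mul1r.
exact: (coord_le_lpnorm +oo%E e i (leey _)).
Qed.

Lemma emp_dotB_le2 N (x y : 'I_N -> 'I_n) h : (0 < N)%N -> (forall i, `|h i| <= 1) ->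
  \sum_i h i * (emp x i - emp y i) <= 2.
Proof.
move=> N0 h1; have NR : 0 < N%:R :> R by rewrite ltr0n.
rewrite emp_dotB ler_pdivrMr// -sumrB.
apply: (@le_trans _ _ (\sum_(k < N) (2 : R))).
  apply: ler_sum => k _; apply: le_trans (ler_norm _) _.
  apply: le_trans (ler_normB _ _) _.
  by rewrite (le_trans (lerD (h1 _) (h1 _))).
by rewrite sumr_const card_ord mulr_natr.
Qed.

End TypeI.

(** * Type II error: closed deviation events, positivity of rho and the separation bound *)

Section TypeII.
Context {R : realType} {n N : nat}.
Implicit Types (p q e f : 'I_n -> R) (pi : \bar R) (beta rho : R).

Lemma mixture_distr p j (t : R) : is_distr p -> 0 <= t <= 1 ->
  is_distr (fun i => (1 - t) * p i + t * (i == j)%:R).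
Proof.
move=> [p0 p1] /andP[t0 t1]; split=> [i|].
  by rewrite addr_ge0// mulr_ge0// ?subr_ge0// ler0n.
rewrite big_split /= -!big_distrr /= p1 mulr1.
rewrite (bigD1 j)//= eqxx big1 => [|i /negbTE -> //].
by rewrite addr0 mulr1 subrK.
Qed.

(** Bernoulli's inequality; it controls the factor lost by perturbing a distribution. *)
Lemma ler_1Bn_expr (t : R) m : 0 <= t <= 1 -> 1 - m%:R * t <= (1 - t) ^+ m.
Proof.
move=> /andP[t0 t1]; elim: m => [|m IH]; first by rewrite mul0r subr0 expr0.
rewrite exprS; apply: (@le_trans _ _ ((1 - t) * (1 - m%:R * t))).
  have : 0 <= m%:R * (t * t) by rewrite mulr_ge0 ?mulr_ge0 ?ler0n.
  by rewrite -natr1 !mulrDl mulrA; lra.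
by apply: ler_wpM2l => //; rewrite subr_ge0.
Qed.

(* Mixing p with a point mass at j, where e j > e . p, turns the closed event
   into a deviation larger than rho, and decreases no probability by more than
   the factor (1 - t) ^ N.  If there is no such j, then e is constant on the
   support of p and the event is null. *)
Lemma closed_deviation_le pi rho beta e p :
  (0 < N)%N -> 0 < rho -> 0 <= beta ->
  (forall v : 'I_n -> R, \sum_(i < n) e i * v i <= lpnorm pi v) ->
  (forall f, is_distr f ->
     Prob_iid f (fun x : {ffun 'I_N -> 'I_n} =>
                   lpnorm pi (fun i => emp x i - f i) > rho) <= beta) ->
  is_distr p ->
  iid_exp p (fun x : {ffun 'I_N -> 'I_n} =>
    (\sum_i e i * (emp x i - p i) <= - rho)%R%:R) <= beta.
Proof.
move=> N0 rho0 beta0 eH Hrho dp; have [p0 p1] := dp.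
set P := iid_exp p _.
have P1 : P <= 1 by apply: iid_exp_le_cst => // x; rewrite (ler_nat R _ 1) leq_b1.
pose m := \sum_i e i * p i.
have dotE (x : {ffun 'I_N -> 'I_n}) f :
    \sum_i e i * (emp x i - f i) = \sum_i e i * emp x i - \sum_i e i * f i.
  by rewrite -sumrB; apply: eq_bigr => i _; rewrite mulrBr.
have [/existsP[j mj]|] := boolP [exists j, m < e j].
  apply/ler_addgt0Pr => eps eps0.
  (* Small enough that N t <= eps: by Bernoulli's inequality the perturbation then costs at most eps
     in probability. *)
  pose t := Num.min 1 (eps / N.+1%:R).
  have t0 : 0 < t by rewrite lt_min ltr01 divr_gt0.
  have t1 : t <= 1 by rewrite ge_min lexx.
  have t01 : 0 <= t <= 1 by rewrite ltW.
  have Nt : N%:R * t <= eps.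
    apply: (@le_trans _ _ (N%:R * (eps / N.+1%:R))).
      by apply: ler_wpM2l; rewrite ?ler0n// ge_min lexx orbT.
    rewrite mulrCA ler_piMr ?(ltW eps0)// ler_pdivrMr ?ltr0n// mul1r ler_nat.
    exact: leqnSn.
  pose f i := (1 - t) * p i + t * (i == j)%:R.
  have df : is_distr f by exact: mixture_distr.
  have fm : m < \sum_i e i * f i.
    have -> : \sum_i e i * f i = (1 - t) * m + t * e j.
      rewrite /f; under eq_bigr do rewrite mulrDr mulrCA [e _ * (t * _)]mulrCA.
      rewrite big_split /= -!big_distrr /=; congr (_ + t * _).
      rewrite (bigD1 j)//= eqxx big1 => [|i /negbTE ->]; last by rewrite mulr0.
      by rewrite addr0 mulr1.
    have : 0 < t * (e j - m) by rewrite mulr_gt0// subr_gt0.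
    by rewrite mulrBr mulrBl mul1r; lra.
  have le1 : (1 - t) ^+ N * P <= beta.
    apply: le_trans (Hrho f df); rewrite Prob_iidE.
    rewrite /P /iid_exp big_distrr /=; apply: ler_sum => x _.
    rewrite mulrA; apply: ler_pM.
    - by rewrite mulr_ge0 ?exprn_ge0 ?subr_ge0//; apply: prodr_ge0 => k _.
    - by rewrite ler0n.
    - rewrite -[X in _ ^+ X]card_ord -prodr_const -big_split /=.
      apply: ler_prod => k _; rewrite mulr_ge0 ?subr_ge0//= lerDl mulr_ge0 ?ler0n//.
      exact: ltW.
    (* On the event, e . emp <= m - rho < e . f - rho, so the duality bound gives a deviation from f
       strictly above rho. *)
    - case: (leP (\sum_i e i * (emp x i - p i)) (- rho)) => [hx|_]; last by rewrite ler0n.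
      suff -> : rho < lpnorm pi (fun i => emp x i - f i) by [].
      rewrite lpnormB.
      apply: lt_le_trans (eH _).
      have -> : \sum_i e i * (f i - emp x i) = - \sum_i e i * (emp x i - f i).
        by rewrite -sumrN; apply: eq_bigr => i _; rewrite -[RHS]mulrN opprB.
      move: hx; rewrite !dotE -/m; lra.
  have le2 : (1 - N%:R * t) * P <= (1 - t) ^+ N * P.
    apply: ler_wpM2r; last exact: ler_1Bn_expr.
    apply: sumr_ge0 => x _; rewrite mulr_ge0 ?ler0n//.
    by apply: prodr_ge0 => k _.
  have NtP : N%:R * t * P <= N%:R * t.
    by rewrite ler_piMr// mulr_ge0 ?ler0n// ltW.
  move: le2; rewrite mulrBl mul1r; lra.
rewrite negb_exists => /forallP em.
(* The terms p i (m - e i) are nonnegative and sum to 0, so each vanishes. *)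
have eqm i : p i != 0 -> e i = m.
  have /eqP : \sum_i p i * (m - e i) = 0.
    under eq_bigr do rewrite mulrBr [p _ * e _]mulrC.
    by rewrite sumrB -big_distrl /= p1 mul1r subrr.
  rewrite psumr_eq0 => [|k _]; last by rewrite mulr_ge0// subr_ge0 leNgt.
  move=> /allP /(_ i (mem_index_enum _)) /=; rewrite mulf_eq0 => /orP[->//|].
  by rewrite subr_eq0 => /eqP ->.
rewrite /P /iid_exp big1// => x _.
(* A sample leaving the support has weight 0; any other has e . emp = m, which exceeds m - rho. *)
have [/existsP[k /eqP pk]|] := boolP [exists k, p (x k) == 0].
  by rewrite (bigD1 k)//= pk !mul0r.
rewrite negb_exists => /forallP pk.
rewrite leNgt (_ : - rho < _) ?mulr0//.
rewrite dotE emp_dot (eq_bigr (fun=> m)) => [|k _]; last exact: eqm.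
rewrite sumr_const card_ord -[m *+ N]mulr_natr mulfK ?pnatr_eq0 -?lt0n//.
by rewrite -/m subrr oppr_lt0.
Qed.

(** For negative rho the deviation event is certain, norms being nonnegative. *)
Lemma deviation_radius_ge0 pi rho beta p : beta < 1 -> is_distr p ->
  Prob_iid p (fun x : {ffun 'I_N -> 'I_n} =>
                lpnorm pi (fun i => emp x i - p i) > rho) <= beta -> 0 <= rho.
Proof.
move=> b1 dp; rewrite Prob_iidE => h; rewrite leNgt; apply/negP => rho0.
suff : 1 <= beta by rewrite leNgt b1.
apply: le_trans h; rewrite -[X in X <= _](@iid_exp_cst R n N p 1 dp).
apply: ler_iid_exp => // x.
by rewrite (lt_le_trans rho0 (lpnorm_ge0 _ _)).
Qed.

(* The distribution with masses 1/(2N) and 1 - 1/(2N) is never an empirical one. *)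
Lemma deviation_radius_gt0 pi rho beta (i j : 'I_n) : (0 < N)%N -> (1 <= pi)%E ->
  beta < 1 -> i != j ->
  (forall f, is_distr f ->
     Prob_iid f (fun x : {ffun 'I_N -> 'I_n} =>
                   lpnorm pi (fun k => emp x k - f k) > rho) <= beta) -> 0 < rho.
Proof.
move=> N0 pi1 b1 ij H; rewrite ltNge; apply/negP => rho0.
have NR : 0 < N%:R :> R by rewrite ltr0n.
have NR1 : 1 <= N%:R :> R by rewrite ler1n.
pose t : R := 1 - (2 * N%:R)^-1.
have t01 : 0 <= t <= 1.
  rewrite subr_ge0 lerBlDr lerDl invr_ge0 mulr_ge0 ?ler0n// andbT.
  by rewrite invf_le1 ?mulr_gt0//; lra.
have d0 : is_distr (fun k : 'I_n => (k == i)%:R : R).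
  split=> [k|]; first by rewrite ler0n.
  by rewrite (bigD1 i)//= eqxx big1 ?addr0// => k /negbTE ->.
pose f := fun k : 'I_n => (1 - t) * (k == i)%:R + t * (k == j)%:R.
have df : is_distr f by exact: mixture_distr.
have fi : f i = (2 * N%:R)^-1.
  by rewrite /f eqxx (negbTE ij) mulr0 addr0 mulr1 /t opprB addrC subrK.
suff : 1 <= beta by rewrite leNgt b1.
apply: le_trans (H f df); rewrite Prob_iidE.
rewrite -[X in X <= _](@iid_exp_cst R n N f 1 df).
apply: ler_iid_exp => // x.
suff -> : rho < lpnorm pi (fun k => emp x k - f k) by [].
apply: le_lt_trans rho0 _.
apply: lt_le_trans (coord_le_lpnorm pi (fun k => emp x k - f k) i pi1).
rewrite normr_gt0 subr_eq0 fi /emp; apply/negP => /eqP.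
(* Clearing denominators in c / N = 1 / (2 N) gives 2 c = 1, impossible by parity. *)
set c := #|_|; move=> /(congr1 (fun z => z * (2 * N%:R))).
rewrite mulVf ?mulf_neq0 ?pnatr_eq0 -?lt0n// mulrCA divfK ?pnatr_eq0 -?lt0n//.
by rewrite -natrM => /eqP; rewrite (eqr_nat R _ 1) => /eqP /(congr1 odd); rewrite oddM.
Qed.

(** Two rho are lost in passing from ||p - q|| to ||fa - fc|| = e . (fa - fc), and four more in
    replacing fa, fc by fb, fd through p and q. Strictness comes from the hypothesis on fb. *)
Lemma dot_lower_bound pi rho (m : R) e p q (fa fb fc fd : 'I_n -> R) : (1 <= pi)%E ->
  (forall v : 'I_n -> R, \sum_(i < n) e i * v i <= lpnorm pi v) ->
  \sum_i e i * (fa i - fc i) = lpnorm pi (fun i => fa i - fc i) ->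
  lpnorm pi (fun i => fa i - p i) <= rho ->
  lpnorm pi (fun i => fc i - q i) <= rho ->
  lpnorm pi (fun i => fd i - q i) <= rho ->
  - rho < \sum_i e i * (fb i - p i) ->
  6 * rho + m <= lpnorm pi (fun i => p i - q i) ->
  m < \sum_i e i * (fb i - fd i).
Proof.
move=> pi1 eH eE ha hc hd hb hpq.
have ha' := le_trans (eH _) ha; have hd' := le_trans (eH _) hd.
have hc' : \sum_i e i * (q i - fc i) <= rho.
  by apply: le_trans (eH _) _; rewrite lpnormB.
have tri : lpnorm pi (fun i => p i - q i)
    <= rho + (lpnorm pi (fun i => fa i - fc i) + rho).
  have -> : (fun i => p i - q i)
      = (fun i => (p i - fa i) + ((fa i - fc i) + (fc i - q i))).
    by apply/funext => i; ring.
  apply: le_trans (ler_lpnormD _ _ _ pi1) _; apply: lerD.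
    by rewrite lpnormB.
  apply: le_trans (ler_lpnormD _ _ _ pi1) _; exact: lerD.
have := le_trans hpq tri; rewrite -eE => {tri hpq ha hc hd eE eH}.
have -> : \sum_i e i * (fb i - fd i) =
  \sum_i e i * (fb i - p i) - \sum_i e i * (fa i - p i) + \sum_i e i * (fa i - fc i)
  - \sum_i e i * (q i - fc i) - \sum_i e i * (fd i - q i).
  rewrite -!sumrN -!big_split /=; apply: eq_bigr => i _; ring.
move: ha' hb hc' hd'.
set A := \sum_i e i * (fa i - p i); set B := \sum_i e i * (fb i - p i).
set C := \sum_i e i * (q i - fc i); set D := \sum_i e i * (fd i - q i).
set S := \sum_i e i * (fa i - fc i).
move: A B C D S => A B C D S; lra.
Qed.

(** The divisor is at most 1 because coordinates are bounded by the norm, and it is positive since e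
    = 0 would contradict 0 <= m < e . v. *)
Lemma normalized_dot_lt pi (m : R) e (v : 'I_n -> R) : (1 <= pi)%E -> 0 <= m ->
  lpnorm pi e = 1 -> m < \sum_i e i * v i ->
  m < \sum_i e i / lpnorm +oo%E e * v i.
Proof.
move=> pi1 m0 e1 lt.
have -> : \sum_i e i / lpnorm +oo%E e * v i = (\sum_i e i * v i) / lpnorm +oo%E e.
  by rewrite big_distrl /=; apply: eq_bigr => i _; rewrite mulrAC.
set M := lpnorm +oo%E e.
have M1 : M <= 1.
  by apply: bigmax_le => // i _; rewrite -e1; exact: coord_le_lpnorm.
have M0 : 0 < M.
  rewrite lt_neqAle lpnorm_ge0 andbT; apply/eqP => M0.
  move: (le_lt_trans m0 lt); rewrite big1 ?ltxx// => i _.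
  have := coord_le_lpnorm +oo%E e i (leey _); rewrite -/M -M0 normr_le0 => /eqP ->.
  by rewrite mul0r.
rewrite ltr_pdivlMr//; apply: le_lt_trans lt.
by rewrite ler_piMr.
Qed.

End TypeII.

(** * Union bound, conditioning on the training samples, and the final assembly *)

Lemma union_bound4 (R : realType) (u v w x y : bool) : (u -> [|| v, w, x | y]) ->
  u%:R <= v%:R + w%:R + x%:R + y%:R :> R.
Proof.
by rewrite -!natrD ler_nat; case: u v w x y => [] [] [] [] [] // /(_ isT).
Qed.

(** Training samples are integrated outermost, so that e and h are fixed while the test samples
    vary. *)
Lemma Prob_iid2_split (R : realType) (n N : nat) (p q : 'I_n -> R)
    (s1 s2 : 'S_(N + N))
    (B : ('I_N -> 'I_n) -> ('I_N -> 'I_n) -> ('I_N -> 'I_n) -> ('I_N -> 'I_n) -> bool) :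
  Prob_iid2 p q (fun X1 X2 : {ffun 'I_(N + N) -> 'I_n} =>
    B (split_tr s1 X1) (split_ts s1 X1) (split_tr s2 X2) (split_ts s2 X2))
  = iid_exp p (fun a : {ffun 'I_N -> 'I_n} => iid_exp q (fun c : {ffun 'I_N -> 'I_n} =>
      iid_exp p (fun b : {ffun 'I_N -> 'I_n} => iid_exp q (fun d : {ffun 'I_N -> 'I_n} =>
        (B a b c d)%:R)))).
Proof.
rewrite Prob_iid2E.
transitivity (iid_exp p (fun X1 : {ffun 'I_(N + N) -> 'I_n} =>
  iid_exp q (fun c : {ffun 'I_N -> 'I_n} => iid_exp q (fun d : {ffun 'I_N -> 'I_n} =>
    (B (split_tr s1 X1) (split_ts s1 X1) c d)%:R)))).
  apply: eq_iid_exp => X1.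
  exact: (iid_exp_split N q s2
    (fun c d => (B (split_tr s1 X1) (split_ts s1 X1) c d)%:R)).
rewrite (iid_exp_split N p s1 (fun a b =>
  iid_exp q (fun c : {ffun 'I_N -> 'I_n} => iid_exp q (fun d : {ffun 'I_N -> 'I_n} =>
    (B a b c d)%:R)))).
by apply: eq_iid_exp => a; rewrite iid_exp_exchange.
Qed.

Theorem theorem2 (R : realType) (n N : nat) (pi : \bar R) (alpha tau : R)
  (E : ('I_N -> 'I_n) -> ('I_N -> 'I_n) -> 'I_n -> R)
  (s1 s2 : 'S_(N + N)) :
  (0 < N)%N -> (1 <= pi)%E ->
  0 < alpha < 1 ->
  0 < tau -> tau ^+ 2 / (1 + 2 / 3 * tau) = 2 / N%:R * ln (2 / alpha) ->
  (forall a b : 'I_N -> 'I_n,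
     \sum_(i < n) E a b i * (emp a i - emp b i)
       = lpnorm pi (fun i => emp a i - emp b i)
     /\ lpnorm (conj_exp pi) (E a b) = 1) ->
  (* (1) type I error *)
  (forall p : 'I_n -> R, is_distr p ->
     Prob_iid2 p p (fun X1 X2 => claims_H1 E s1 s2 tau X1 X2) <= alpha)
  /\
  (* (2) type II error *)
  (forall (beta rho : R), 0 < beta < 1 / 4 ->
     (forall f : 'I_n -> R, is_distr f ->
        Prob_iid f (fun x : {ffun 'I_N -> 'I_n} =>
                      lpnorm pi (fun i => emp x i - f i) > rho) <= beta) ->
     forall p q : 'I_n -> R, is_distr p -> is_distr q ->
       lpnorm pi (fun i => p i - q i) >= 6 * rho + 2 * Num.min 1 tau ->
       Prob_iid2 p q (fun X1 X2 => ~~ claims_H1 E s1 s2 tau X1 X2) <= 4 * beta).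
Proof.
move=> N0 pi1 alpha01 tau0 tauE HE.
pose h (a c : 'I_N -> 'I_n) i := E a c i / lpnorm +oo%E (E a c).
have h1 a c i : `|h a c i| <= 1 by exact: normalized_coord_le1.
pose claim (a b c d : 'I_N -> 'I_n) :=
  \sum_i h a c i * (emp b i - emp d i) > 2 * Num.min 1 tau.
split=> [p dp|beta rho /andP[beta0 beta1] Hrho p q dp dq Hpq].
  rewrite [X in X <= _](Prob_iid2_split R n N p p s1 s2 claim).
  apply: iid_exp_le_cst => // a; apply: iid_exp_le_cst => // c; rewrite /claim.
  have [tau1|tau1] := leP 1 tau.
    (* The threshold is 2 here, which the statistic never exceeds. *)
    apply: iid_exp_le_cst => // b; apply: iid_exp_le_cst => // d.
    by rewrite mulr1 ltNge (emp_dotB_le2 _ _ _ _ N0 (h1 a c)) ltW//; case/andP: alpha01.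
  apply: le_trans (chernoff_le_alpha N alpha tau N0 alpha01 tau0 tauE).
  exact: two_sample_chernoff.
have m0 : 0 < 2 * Num.min 1 tau by rewrite mulr_gt0// lt_min ltr01.
have beta_lt1 : beta < 1 by lra.
have rho_ge0 : 0 <= rho := deviation_radius_ge0 pi rho beta p beta_lt1 dp (Hrho p dp).
have rho0 : 0 < rho.
  have [[i j] /= ij|n1] := pickP (fun ij : 'I_n * 'I_n => ij.1 != ij.2).
    exact: (deviation_radius_gt0 pi rho beta i j N0 pi1 beta_lt1 ij Hrho).
  (* With at most one outcome, p = q; the separation hypothesis then contradicts rho >= 0 and the
     positive threshold. *)
  have eqpq i : p i - q i = 0.
    have pt (f : 'I_n -> R) : is_distr f -> f i = 1.
      move=> [_ <-]; rewrite (bigD1 i)//= big1 ?addr0// => k ki.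
      by have := n1 (k, i); rewrite /= ki.
    by rewrite !pt// subrr.
  have pq0 : (fun i => p i - q i) = (fun=> 0) by apply/funext.
  by move: Hpq; rewrite pq0 lpnorm0//; move: (2 * Num.min 1 tau) m0 => m m0; lra.
rewrite [X in X <= _](Prob_iid2_split R n N p q s1 s2 (fun a b c d => ~~ claim a b c d)).
have Hdual a c v : \sum_i E a c i * v i <= lpnorm pi v.
  by apply: hoelder_lpnorm => //; case: (HE a c).
pose dev f (x : {ffun 'I_N -> 'I_n}) : R := (lpnorm pi (fun i => emp x i - f i) > rho)%R%:R.
pose wk a c (x : {ffun 'I_N -> 'I_n}) : R :=
  (\sum_i E a c i * (emp x i - p i) <= - rho)%R%:R.
have devb f : is_distr f -> iid_exp f (dev f) <= beta.
  by move=> df; have := Hrho f df; rewrite Prob_iidE.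
have wkb a c : iid_exp p (wk a c) <= beta.
  exact: (closed_deviation_le pi rho beta (E a c) p N0 rho0 (ltW beta0)).
have bound (a b c d : {ffun 'I_N -> 'I_n}) :
    (~~ claim a b c d)%:R <= dev p a + dev q c + wk a c b + dev q d.
  (* Contrapositive: outside all four bad events the test claims H1. *)
  apply: union_bound4; apply: contraNT; rewrite !negb_or -!leNgt -ltNge.
  move=> /and4P[ha hc hb hd].
  apply: (@normalized_dot_lt _ _ (conj_exp pi)); [exact: conj_exp_ge1|exact: ltW| |].
    by case: (HE a c).
  apply: (@dot_lower_bound _ _ pi rho _ _ p q (emp a) (emp b) (emp c) (emp d)) => //.
  by case: (HE a c).
(* The samples are integrated out in the order d, b, c, a, each costing one beta; the bound for [wk]
   is uniform in the training samples a, c. *)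
apply: (@le_trans _ _ (iid_exp p (fun a => iid_exp q (fun c =>
    dev p a + dev q c + beta + beta)))).
  apply: ler_iid_exp => // a; apply: ler_iid_exp => // c.
  apply: (@le_trans _ _ (iid_exp p (fun b => dev p a + dev q c + wk a c b + beta))).
    apply: ler_iid_exp => // b.
    apply: (@le_trans _ _ (iid_exp q (fun d => dev p a + dev q c + wk a c b + dev q d))).
      by apply: ler_iid_exp => // d; exact: bound.
    by rewrite iid_expD iid_exp_cst// lerD2l devb.
  by rewrite !iid_expD !iid_exp_cst// lerD2r lerD2l wkb.
apply: (@le_trans _ _ (iid_exp p (fun a => dev p a + beta + beta + beta))).
  apply: ler_iid_exp => // a; rewrite !iid_expD !iid_exp_cst//.
  by rewrite !lerD2r lerD2l devb.
rewrite !iid_expD !iid_exp_cst//.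
have := devb p dp; set x := iid_exp p _; move: x => x; lra.
Qed.
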